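(* Assume that $\gamma\in(1,\infty)$, $x_0\in\mathbb R$ and $\delta(\varepsilon)=1$. Then for any fixed $n\in\mathbb N=\{0,1,2,\dots\}$ there is no cut-off: there do not exist times $t_\varepsilon>0$ such that $$\lim_{\varepsilon\to0}d_{n,\varepsilon}(ct_\varepsilon,x_0)=\begin{cases}\infty & \text{for } c\in(0,1),\\ 0 & \text{for } c\in(1,\infty).\end{cases}$$
   Context: Let $V(x)=\frac{1}{\gamma+1}|x|^{\gamma+1}$, $x\in\mathbb R$, with $\gamma>0$. For $\varepsilon\in(0,1]$ let $\mathcal L_\varepsilon u=\varepsilon u''-V'u'$ and let $\varrho_{\varepsilon,\infty}(x)=C_\varepsilon e^{-V(x)/\varepsilon}$, where $C_\varepsilon$ makes it a probability density. The operator $-\mathcal L_\varepsilon$ on $L^2(\varrho_{\varepsilon,\infty}dx)$ has discrete simple spectrum $0=\lambda_{0,\varepsilon}<\lambda_{1,\varepsilon}<\lambda_{2,\varepsilon}<\cdots$ with eigenfunctions $\psi_{0,\varepsilon}=1,\psi_{1,\varepsilon},\psi_{2,\varepsilon},\dots$ forming an orthonormal basis of $L^2(\varrho_{\varepsilon,\infty}dx)$. The initial density is $\varrho_{\varepsilon,0}=\frac{1}{2\delta(\varepsilon)}\mathbf 1_{(x_0-\delta(\varepsilon),x_0+\delta(\varepsilon))}$, and $\varrho_{\varepsilon,t}$ denotes the solution at time $t$ of the Fokker–Planck equation $\partial_t\varrho=(\varrho V'+\varepsilon\varrho')'$ with initial datum $\varrho_{\varepsilon,0}$. Let $\Pi_{n,\varepsilon}f=\sum_{k=0}^n\langle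 f,\psi_{k,\varepsilon}\rangle_{L^2(\varrho_{\varepsilon,\infty}dx)}\psi_{k,\varepsilon}$. The truncated $\chi^2$-distance is $$d_{n,\varepsilon}(t,x_0)=\left(\int_{\mathbb R}\left|\Pi_{n,\varepsilon}\left[\frac{\varrho_{\varepsilon,t}}{\varrho_{\varepsilon,\infty}}\right](x)-1\right|^2\varrho_{\varepsilon,\infty}(x)\,dx\right)^{1/2},\quad t\ge0,$$ equivalently $$d_{n,\varepsilon}(t,x_0)=\left(\sum_{k=1}^n e^{-2\lambda_{k,\varepsilon}t}\left(\int_{\mathbb R}\varrho_{\varepsilon,0}(x)\psi_{k,\varepsilon}(x)\,dx\right)^2\right)^{1/2}.$$ *)

(* Defs.v *)
From HB Require Import structures.
From mathcomp Require Import all_boot all_order all_algebra.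
From mathcomp Require Import all_classical all_reals all_analysis.
From mathcomp Require Import measurable_realfun.
Set Implicit Arguments.
Unset Strict Implicit.
Unset Printing Implicit Defensive.
Import Order.TTheory GRing.Theory Num.Theory.
Import numFieldNormedType.Exports.
Local Open Scope ring_scope.
Local Open Scope classical_set_scope.

Section Defs.
Context {R : realType}.
Implicit Types (gamma eps : R) (u f g : R -> R).

Local Notation mu := (@lebesgue_measure R).

Definition V gamma : R -> R := fun x => (gamma + 1)^-1 * `|x| `^ (gamma + 1).

Definition generator gamma eps u : R -> R :=
  fun x => eps * derive1 (derive1 u) x - derive1 (V gamma) x * derive1 u x.

Definition rho_inf gamma eps : R -> R := fun x =>
  (\int[mu]_y expR (- V gamma y / eps))^-1 * expR (- V gamma x / eps).

Definition L2 gamma eps f : Prop :=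
  measurable_fun setT f /\
  mu.-integrable setT (fun x => (f x ^+ 2 * rho_inf gamma eps x)%:E).

Definition inner gamma eps f g : R :=
  \int[mu]_x (f x * g x * rho_inf gamma eps x).

(* Eigenfunctions of the self-adjoint operator [- generator] on
   L^2(rho_inf dx). The operator is in the limit-point case at both ends of
   the line, so its domain is the maximal one and no boundary condition is
   imposed; V' being continuous, every eigenfunction has a twice continuously
   differentiable representative, which is the one considered here. *)
Definition eigenfunction gamma eps (l : R) u : Prop :=
  [/\ L2 gamma eps u, exists x, u x != 0,
      forall x, derivable u x 1, forall x, derivable (derive1 u) x 1
    & forall x, - generator gamma eps u x = l * u x].

Definition Pi gamma eps (psi : nat -> R -> R) (n : nat) f : R -> R :=
  fun x => \sum_(k < n.+1) inner gamma eps f (psi k) * psi k x.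

(* Given the orthonormal basis of eigenfunctions, the divergence of the
   eigenvalues says that the spectrum is discrete and equal to their set. *)
Definition spectral_system gamma eps (lambda : nat -> R)
    (psi : nat -> R -> R) : Prop :=
  (lambda 0%N = 0 /\ (forall x, psi 0%N x = 1)) /\
  (forall k, lambda k < lambda k.+1) /\
  (lambda k @[k --> \oo] --> +oo) /\
  (forall k, eigenfunction gamma eps (lambda k) (psi k)) /\
  (forall l u, eigenfunction gamma eps l u ->
     exists k, l = lambda k /\ exists c, forall x, u x = c * psi k x) /\
  (forall j k, inner gamma eps (psi j) (psi k) = (j == k)%:R) /\
  (forall f, L2 gamma eps f ->
     let r n := fun x => f x - Pi gamma eps psi n f x in
     inner gamma eps (r n) (r n) @[n --> \oo] --> (0 : R)).

Definition init_density (x0 delta : R) : R -> R :=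
  fun x => (2 * delta)^-1 * \1_(`]x0 - delta, x0 + delta[%classic) x.

Definition flux gamma eps f : R -> R :=
  fun x => f x * derive1 (V gamma) x + eps * derive1 f x.

(* Solutions [rho t x], for t >= 0, of the Fokker-Planck equation: probability
   densities that solve it classically for t > 0, such that t |-> rho t / rho_inf
   is continuous from [0, +oo[ to L^2(rho_inf dx). *)
Definition fokker_planck_solution gamma eps (rho_init : R -> R)
    (rho : R -> R -> R) : Prop :=
  let h t := fun x => rho t x / rho_inf gamma eps x in
  (forall x, rho 0 x = rho_init x) /\
  (forall t : R, 0 <= t -> (forall x, 0 <= rho t x) /\ \int[mu]_x rho t x = 1) /\
  (forall t : R, 0 <= t -> L2 gamma eps (h t)) /\
  (forall t : R, 0 <= t ->
     inner gamma eps (fun x => h s x - h t x) (fun x => h s x - h t x)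
       @[s --> within [set s | 0 <= s] (nbhs t)] --> (0 : R)) /\
  (forall t x : R, 0 < t ->
     [/\ derivable (fun s => rho s x) t 1, derivable (rho t) x 1,
         derivable (flux gamma eps (rho t)) x 1
       & derive1 (fun s => rho s x) t = derive1 (flux gamma eps (rho t)) x]) /\
  (forall z : R * R, 0 < z.1 ->
     [/\ {for z, continuous (fun w : R * R => rho w.1 w.2)},
         {for z, continuous (fun w : R * R => derive1 (rho w.1) w.2)}
       & {for z, continuous (fun w : R * R => derive1 (fun s => rho s w.2) w.1)}]).

(* Truncated chi^2-distance, as a function of the density [rho_t] at time t. *)
Definition chi2_dist gamma eps (psi : nat -> R -> R) (n : nat)
    (rho_t : R -> R) : R :=
  Num.sqrt (\int[mu]_x
    (`|Pi gamma eps psi n (fun y => rho_t y / rho_inf gamma eps y) x - 1| ^+ 2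
     * rho_inf gamma eps x)).

(* [d eps t] is only meaningful for 0 < eps <= 1 and t >= 0. *)
Definition cutoff (d : R -> R -> R) : Prop :=
  exists t : R -> R,
    (forall eps, 0 < eps <= 1 -> 0 < t eps) /\
    (forall c : R, 0 < c < 1 -> d eps (c * t eps) @[eps --> 0^'+] --> +oo) /\
    (forall c : R, 1 < c -> d eps (c * t eps) @[eps --> 0^'+] --> (0 : R)).

End Defs.

(* Main.v *)
Require Import Defs.
From HB Require Import structures.
From mathcomp Require Import all_boot all_order all_algebra.
From mathcomp Require Import all_classical all_reals all_analysis.
From mathcomp Require Import measurable_realfun.
From mathcomp Require Import ring lra.
Import Order.TTheory GRing.Theory Num.Theory.
Import numFieldNormedType.Exports.
Local Open Scope ring_scope.
Local Open Scope classical_set_scope.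

(** The truncated distance stays bounded, uniformly in time and in eps, so it
cannot diverge along c t_eps for any c in (0,1).

The coefficient of rho_t / rho_inf along psi_k is the integral of psi_k
against the probability density rho_t, hence at most the supremum of |psi_k|.
This controls the distance by a polynomial in the suprema of the first n + 1
eigenfunctions ([chi2_dist_le]). It remains to bound these suprema
independently of eps.

The dependence on eps is removed by scaling. The potential is homogeneous, so
x |-> b x with b ^ (gamma + 1) = eps maps the eigenfunctions at level eps to
eigenfunctions at level 1, multiplying eigenvalues by b ^ (1 - gamma) and
preserving L^2 norms ([eigenfunction_scale], [inner_scale]). Both spectra are
listed in increasing order and correspond to each other, so psi_k at level eps
is, up to sign, a rescaled psi_j at level 1 with j <= k.

What is left is that each single eigenfunction at level 1 is bounded
([eigenfunction_bounded]); this is where gamma > 1 enters. For large x > 0 the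
equation u'' = x ^ gamma u' - l u has two kinds of solutions: those whose
derivative grows like exp V, and those governed by u' ~ (l / x ^ gamma) u,
which stay bounded because x ^ (- gamma) is integrable at infinity. The first
kind is not in L^2(exp (- V)). The proof of this dichotomy ([ode_bounded_or_not_L2]) compares
u with a positive supersolution exp G, G' = (l + 1) x ^ (- gamma), through two
monotone quantities, which spares any analysis of the zeros of u. *)

(** * The eigenvalue equation on a half-line *)

Lemma ge0_is_derive_homo (R : realType) (f f' : R -> R) (a : R) :
  (forall x, a <= x -> is_derive x 1 f (f' x)) ->
  (forall x, a <= x -> 0 <= f' x) ->
  forall x y, a <= x -> x <= y -> f x <= f y.
Proof.
move=> df f'_ge0; apply: ger0_derive1_ndecry => [x|x|].
- by rewrite in_itv/= andbT => /ltW/df[].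
- rewrite in_itv/= andbT => /ltW ax; have fx := df _ ax.
  by rewrite derive1E derive_val f'_ge0.
- apply: derivable_within_continuous => x.
  by rewrite in_itv/= andbT => /df[].
Qed.

Section HalfLine.
Context {R : realType}.
Variables (gamma l : R) (u u1 : R -> R).
Hypotheses (gamma_gt1 : 1 < gamma) (l_ge0 : 0 <= l).
Hypothesis du : forall x : R, 0 < x -> is_derive x 1 u (u1 x).
Hypothesis du1 : forall x : R, 0 < x ->
  is_derive x 1 u1 (x `^ gamma * u1 x - l * u x).

(** [W] is the potential on the half-line and [exp G], with [G' = g], is the
supersolution: [m] is minus the value at [exp G] of the operator
[f'' - x ^ gamma f' + l f], divided by [exp G]. The function [q] is [exp G]
times the derivative of [u exp (- G)], so the sign of [u q] tells whether [|u|]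
grows relatively to [exp G]. *)
Let W (x : R) := (gamma + 1)^-1 * x `^ (gamma + 1).
Let g (x : R) := (l + 1) * x `^ (- gamma).
Let G (x : R) := - ((l + 1) / (gamma - 1)) * x `^ (1 - gamma).
Let q (x : R) := u1 x - g x * u x.
Let m (x : R) := 1 - g x ^+ 2 + (l + 1) * gamma * x `^ (- gamma - 1).

Local Ltac slra := have ? := gamma_gt1; have ? := l_ge0; lra.

Let g1_gt0 : 0 < gamma + 1. Proof. slra. Qed.

Let dW (x : R) : 0 < x -> is_derive x 1 W (x `^ gamma).
Proof.
move=> x0; rewrite /W; have ? := is_derive1_powR (gamma + 1) x0.
apply: is_derive_eq; rewrite /GRing.scale/= addrK; field.
exact: lt0r_neq0.
Qed.

Let dG (x : R) : 0 < x -> is_derive x 1 G (g x).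
Proof.
move=> x0; rewrite /G; have ? := is_derive1_powR (1 - gamma) x0.
apply: is_derive_eq.
rewrite /g /GRing.scale/=.
rewrite (_ : 1 - gamma - 1 = - gamma); last by ring.
by field; rewrite subr_eq0 gt_eqF.
Qed.

Let dg (x : R) : 0 < x -> is_derive x 1 g (- (l + 1) * gamma * x `^ (- gamma - 1)).
Proof.
move=> x0; rewrite /g; have ? := is_derive1_powR (- gamma) x0.
apply: is_derive_eq.
rewrite /GRing.scale/=; ring.
Qed.

Let gV (x : R) : 0 < x -> x `^ gamma * g x = l + 1.
Proof.
move=> x0; rewrite /g powRN; field.
by rewrite gt_eqF// powR_gt0.
Qed.

Let dq (x : R) : 0 < x -> is_derive x 1 q ((x `^ gamma - g x) * q x + m x * u x).
Proof.
move=> x0; rewrite /q.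
have ? := du _ x0; have ? := du1 _ x0; have ? := dg _ x0.
apply: is_derive_eq.
rewrite /GRing.scale/= /m.
have := gV _ x0; set p := x `^ _; set gx := g x => h.
have -> : (p - gx) * (u1 x - gx * u x) =
  p * u1 x - (p * gx) * u x - gx * u1 x + gx ^+ 2 * u x by ring.
rewrite h; ring.
Qed.

(* Beyond l + 1 one has x ^ gamma >= x >= l + 1, i.e. g <= 1. *)
Let m_ge0 (x : R) : l + 1 <= x -> 0 <= m x.
Proof.
move=> lx; have x0 : 0 < x by slra.
have g1 : g x <= 1.
  rewrite -(ler_pM2l (powR_gt0 gamma x0)) gV// mulr1 (le_trans lx)//.
  by rewrite le1r_powR//; slra.
have g0 : 0 <= g x by rewrite mulr_ge0 ?powR_ge0//; slra.
rewrite /m addr_ge0 ?subr_ge0 ?expr_le1//.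
by rewrite !mulr_ge0 ?powR_ge0//; slra.
Qed.

Let N (x : R) := u x * q x * expR (- W x).

(** The weight [exp (- W)] cancels the drift, so that [N'] is a
combination of squares, nonnegative beyond [l + 1] whatever the sign of [u]. *)
Let dN (x : R) : 0 < x ->
  is_derive x 1 N ((q x ^+ 2 + m x * u x ^+ 2) * expR (- W x)).
Proof.
move=> x0; rewrite /N.
have ? := du _ x0; have ? := dq _ x0; have ? := dW _ x0.
apply: is_derive_eq.
rewrite /GRing.scale/= /q; ring.
Qed.

Let N_homo (x y : R) : l + 1 <= x -> x <= y -> N x <= N y.
Proof.
move: x y; apply: ge0_is_derive_homo => [x lx|x lx].
  by apply: dN; slra.
rewrite mulr_ge0 ?expR_ge0// addr_ge0 ?sqr_ge0//.
by rewrite mulr_ge0 ?sqr_ge0 ?m_ge0.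
Qed.

(* This uses gamma > 1: g has an antiderivative bounded above at infinity. *)
Let G_le0 (x : R) : G x <= 0.
Proof.
rewrite /G mulNr oppr_le0 mulr_ge0 ?powR_ge0// divr_ge0//; slra.
Qed.

(** If [u q] never becomes positive, [|u exp (- G)|] is nonincreasing. *)
Let bounded_case : (forall x : R, l + 1 <= x -> N x <= 0) ->
  exists C, forall x : R, l + 1 <= x -> `|u x| <= C.
Proof.
move=> N0.
pose v x := - (u x * expR (- G x)) ^+ 2.
pose v' x := (- 2 * N x) * (expR (W x) * expR (- G x) ^+ 2).
have dv x : l + 1 <= x -> is_derive x 1 v (v' x).
  move=> lx; have x0 : 0 < x by slra.
  have ? := du _ x0; have ? := dG _ x0; rewrite /v; apply: is_derive_eq.
  rewrite /v' /N (expRN (W x)) /GRing.scale/= /q; field.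
  by rewrite gt_eqF ?expR_gt0.
have vhomo : forall x y, l + 1 <= x -> x <= y -> v x <= v y.
  apply: (ge0_is_derive_homo _ _ _ _ dv) => x lx.
  apply: mulr_ge0; last by rewrite mulr_ge0 ?sqr_ge0 ?expR_ge0.
  by have := N0 _ lx; slra.
exists (`|u (l + 1) * expR (- G (l + 1))|) => x lx.
have /= := vhomo _ _ (lexx _) lx.
rewrite /v lerN2 -ler_sqrt ?sqr_ge0// !sqrtr_sqr; apply: le_trans.
rewrite normrM ler_peMr// ger0_norm ?expR_ge0//.
by rewrite -[leLHS]expR0 ler_expR oppr_ge0.
Qed.


(** Once [u q] is positive at [x1], it stays so, and then [q exp (G - W)] is
nondecreasing in absolute value. Hence [|u'|] dominates [exp W], which leaves
[u ^ 2 exp (- W)] bounded below. *)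
Let growth_case (x1 : R) : l + 1 <= x1 -> 0 < N x1 ->
  exists2 c : R, 0 < c & exists A : R, forall x : R, A <= x ->
    c <= u x ^+ 2 * expR (- W x).
Proof.
move=> lx1 N1.
have x1_gt0 : 0 < x1 by slra.
have N_gt0 (x : R) : x1 <= x -> 0 < N x.
  by move=> /(N_homo _ _ lx1); apply: lt_le_trans.
have uq_gt0 (x : R) : x1 <= x -> 0 < u x * q x.
  by move=> /N_gt0; rewrite /N pmulr_lgt0 ?expR_gt0.
pose T (x : R) := q x * expR (G x - W x).
have T_homo (x y : R) : x1 <= x -> x <= y -> T x ^+ 2 <= T y ^+ 2.
  move: x y; apply: (ge0_is_derive_homo _ _
    (fun x => 2 * (m x * expR (G x - W x) ^+ 2) * (u x * q x))) => x xx1.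
    have x0 : 0 < x by slra.
    have ? := dq _ x0; have ? := dG _ x0; have ? := dW _ x0.
    rewrite /T; apply: is_derive_eq.
    by rewrite /GRing.scale/=; ring.
  apply: mulr_ge0; last exact/ltW/uq_gt0.
  by rewrite !mulr_ge0 ?sqr_ge0 ?m_ge0//; slra.
pose c := `|T x1|.
have c_gt0 : 0 < c.
  rewrite normr_gt0 mulf_neq0 ?(lt0r_neq0 (expR_gt0 _))//.
  by have := uq_gt0 _ (lexx x1); apply: contraTneq => ->; rewrite mulr0 ltxx.
have q_ge (x : R) : x1 <= x -> c * expR (W x) <= `|q x|.
  move=> xx1.
  have : c <= `|T x|.
    by rewrite /c -(sqrtr_sqr (T x1)) -(sqrtr_sqr (T x)) ler_sqrt ?sqr_ge0// T_homo.
  rewrite /T normrM (ger0_norm (expR_ge0 _)) expRD expRN => cT.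
  rewrite -ler_pdivlMr ?expR_gt0// (le_trans cT)//.
  rewrite ler_wpM2l// ler_piMl ?invr_ge0 ?expR_ge0//.
  by rewrite -expR0 ler_expR.
have u_neq0 (x : R) : x1 <= x -> u x != 0.
  by move=> /uq_gt0; apply: contraTneq => ->; rewrite mul0r ltxx.
have xgW (x : R) : x1 <= x -> x `^ gamma <= 2 * (gamma + 1) * expR (W x / 2).
  move=> xx1; have x0 : 0 < x by slra.
  have h1 : x `^ gamma <= x `^ (gamma + 1).
    by rewrite ler_powR//; slra.
  have h2 := expR_ge1Dx (W x / 2).
  have h3 : x `^ (gamma + 1) = (gamma + 1) * W x.
    by rewrite /W mulrA divff ?mul1r// gt_eqF.
  apply: (le_trans h1); rewrite h3 mulrAC [leRHS]mulrC ler_wpM2l ?(ltW g1_gt0)//.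
  lra.
(* The weaker rate exp (W / 2) suffices, and unlike exp W it has a derivative
   that is dominated by exp W; k makes this domination exact. *)
pose k := c / (gamma + 1).
have k_gt0 : 0 < k by rewrite divr_gt0.
pose F (x : R) := Num.sqrt (u x ^+ 2) - k * expR (W x / 2).
have F_homo (x y : R) : x1 <= x -> x <= y -> F x <= F y.
  move: x y; apply: (ge0_is_derive_homo _ _
    (fun x => (2 * `|u x|)^-1 * (2 * (u x * u1 x)) -
       k * (x `^ gamma / 2 * expR (W x / 2)))) => x xx1.
    have x0 : 0 < x by slra.
    have ? := du _ x0; have ? := dW _ x0.
    have ux2 : 0 < u x ^+ 2 by rewrite exprn_even_gt0//= u_neq0.
    have ? := is_derive1_sqrt ux2.
    rewrite /F -sqrtr_sqr; apply: is_derive_eq.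
    by rewrite /GRing.scale/=; ring.
  have au : 0 < `|u x| by rewrite normr_gt0 u_neq0.
  have g0 : 0 <= g x by rewrite mulr_ge0 ?powR_ge0//; slra.
  have uq_le : `|u x| * `|q x| <= u x * u1 x.
    rewrite -normrM gtr0_norm ?uq_gt0// /q mulrBr lerBlDr lerDl.
    by rewrite mulrCA mulr_ge0// -expr2 sqr_ge0.
  have -> : (2 * `|u x|)^-1 * (2 * (u x * u1 x)) = (u x * u1 x) / `|u x|.
    by field; rewrite gt_eqF.
  rewrite subr_ge0; apply: (@le_trans _ _ `|q x|).
    apply: le_trans (q_ge _ xx1).
    have -> : c * expR (W x) = k * ((gamma + 1) * expR (W x / 2) * expR (W x / 2)).
      rewrite -mulrA -expRD -splitr /k; field.
      by rewrite gt_eqF.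
    rewrite ler_wpM2l ?(ltW k_gt0)// ler_wpM2r ?expR_ge0//.
    by rewrite ler_pdivrMr//; have := xgW _ xx1; lra.
  by rewrite ler_pdivlMr// mulrC.
exists (k ^+ 2 / 4); first by rewrite divr_gt0 ?exprn_gt0.
(* From this point on the constant of integration is at most half of the
   growing term. *)
exists (Num.max x1 (4 * (gamma + 1) * expR (W x1 / 2))) => x.
rewrite ge_max => /andP[xx1 xA].
have x0 : 0 < x by slra.
have eW : 2 * expR (W x1 / 2) <= expR (W x / 2).
  have h1 : x <= (gamma + 1) * W x.
    rewrite /W mulrA divff ?mul1r ?gt_eqF// le1r_powR//; slra.
  have h2 := expR_ge1Dx (W x / 2).
  rewrite -(ler_pM2l g1_gt0).
  apply: (@le_trans _ _ ((gamma + 1) * (1 + W x / 2))); last first.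
    by rewrite ler_wpM2l ?(ltW g1_gt0).
  by rewrite mulrDr mulr1; slra.
have Fx := F_homo _ _ (lexx _) xx1.
have Fx1 : - k * expR (W x1 / 2) <= F x1.
  by rewrite /F mulNr lerDr sqrtr_ge0.
have ux : k / 2 * expR (W x / 2) <= `|u x|.
  rewrite -sqrtr_sqr.
  have : F x + k * expR (W x / 2) = Num.sqrt (u x ^+ 2) by rewrite /F subrK.
  have : k * (2 * expR (W x1 / 2)) <= k * expR (W x / 2).
    by rewrite ler_wpM2l ?(ltW k_gt0).
  by lra.
rewrite expRN ler_pdivlMr ?expR_gt0// -(real_normK (num_real (u x))).
have -> : k ^+ 2 / 4 * expR (W x) = (k / 2 * expR (W x / 2)) ^+ 2.
  by rewrite [in LHS](splitr (W x)) expRD; field.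
by rewrite lerXn2r ?nnegrE// mulr_ge0 ?expR_ge0 ?divr_ge0 ?ltW.
Qed.

(** With [W] the potential, the second alternative rules out that
[u ^ 2 exp (- W)] be integrable at infinity. *)
Lemma ode_bounded_or_not_L2 :
  (exists C : R, forall x : R, l + 1 <= x -> `|u x| <= C) \/
  (exists2 c : R, 0 < c & exists A : R, forall x : R, A <= x ->
     c <= u x ^+ 2 * expR (- W x)).
Proof.
have [|] := pselect (forall x : R, l + 1 <= x -> N x <= 0).
  by move/bounded_case; left.
move/existsNP => [x1 /not_implyP[lx1 /negP]]; rewrite -ltNge => Nx1.
by right; exact: growth_case Nx1.
Qed.

End HalfLine.

(** * The potential and the equilibrium density *)

Lemma is_derive_V (R : realType) (gamma x : R) : 1 < gamma ->
  is_derive x 1 (V gamma) (Num.sg x * `|x| `^ gamma).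
Proof.
move=> gamma_gt1.
have g1_gt0 : 0 < gamma + 1 by lra.
have pos (y : R) : 0 < y -> is_derive y 1 (V gamma) (y `^ gamma).
  move=> y0.
  pose W (x : R) := (gamma + 1)^-1 * x `^ (gamma + 1).
  have dW : is_derive y 1 W (y `^ gamma).
    rewrite /W; have ? := is_derive1_powR (gamma + 1) y0.
    apply: is_derive_eq; rewrite /GRing.scale/= addrK; field.
    exact: lt0r_neq0.
  apply: near_eq_is_derive dW.
  near=> z; rewrite /W /V gtr0_norm//.
  by near: z; exact: lt_nbhsr.
have [x0|x0|->] := ltgtP x 0.
- have ? : is_derive (- x) 1 (V gamma) ((- x) `^ gamma).
    by apply: pos; rewrite oppr_gt0.
  have -> : V gamma = V gamma \o -%R.
    by apply/funext => y; rewrite /V /= normrN.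
  rewrite ltr0_sg// ltr0_norm//.
  apply: is_derive_eq; rewrite /GRing.scale/=; ring.
- by rewrite gtr0_sg// mul1r gtr0_norm//; exact: pos.
rewrite sgr0 mul0r.
(* At the origin the difference quotient is V z / z. *)
apply/is_derive1_caratheodory.
exists (fun z => (gamma + 1)^-1 * (Num.sg z * `|z| `^ gamma)); split.
- move=> z; rewrite /V normr0 powR0 ?mulr0 ?subr0 ?gt_eqF//.
  rewrite -mulrA; congr (_ * _).
  have [->|z0] := eqVneq z 0; first by rewrite normr0 powR0 ?mulr0 ?gt_eqF.
  rewrite powRD; last by rewrite gt_eqF.
  by rewrite powRr1// mulrAC -normrEsg mulrC.
- suff h : (gamma + 1)^-1 * (Num.sg z * `|z| `^ gamma) @[z --> (0:R)] -->
    (gamma + 1)^-1 * (Num.sg (0:R) * `|0:R| `^ gamma) by exact: h.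
  rewrite sgr0 mul0r mulr0.
  apply/cvgr0Pnorm_le => e e0.
  suff : \forall z \near (0:R),
    `|(gamma + 1)^-1 * (Num.sg z * `|z| `^ gamma)| <= e by [].
  near=> z.
  have zs : `|z| <= 1 by near: z; exact: (@nbhs0_le _ R^o).
  have ze : `|z| <= e by near: z; exact: (@nbhs0_le _ R^o).
  rewrite !normrM normr_sg (ger0_norm (powR_ge0 _ _)).
  rewrite gtr0_norm ?invr_gt0//.
  have zg : `|z| `^ gamma <= `|z|.
    have [->|z0] := eqVneq z 0; first by rewrite normr0 powR0// gt_eqF//; lra.
    by rewrite ge1r_powR// ?normr_gt0 ?z0//=; lra.
  have s1 : (z != 0)%:R * `|z| `^ gamma <= e.
    case: (z != 0); last by rewrite mul0r ltW.
    by rewrite mul1r (le_trans zg).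
  apply: le_trans s1; rewrite ler_piMl// ?mulr_ge0 ?powR_ge0//.
  by rewrite invf_le1//; lra.
by rewrite sgr0 mul0r mulr0.
Unshelve. all: by end_near.
Qed.

Lemma derivable_is_derive1 (R : realType) (f : R -> R) (x : R) :
  derivable f x 1 -> is_derive x 1 f (derive1 f x).
Proof. by rewrite derive1E => /derivableP. Qed.

Lemma VE_ge0 (R : realType) (gamma x : R) : 0 <= x ->
  V gamma x = (gamma + 1)^-1 * x `^ (gamma + 1).
Proof. by move=> x0; rewrite /V ger0_norm. Qed.

Lemma VN (R : realType) (gamma x : R) : V gamma (- x) = V gamma x.
Proof. by rewrite /V normrN. Qed.

Lemma derive1_VE (R : realType) (gamma x : R) : 1 < gamma ->
  derive1 (V gamma) x = Num.sg x * `|x| `^ gamma.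
Proof.
move=> gamma_gt1; have ? := is_derive_V _ _ x gamma_gt1.
by rewrite derive1E derive_val.
Qed.

Lemma continuous_V (R : realType) (gamma : R) : 1 < gamma ->
  continuous (V gamma).
Proof.
move=> gamma_gt1 x; have [? _] := is_derive_V _ _ x gamma_gt1.
exact/differentiable_continuous/derivable1_diffP.
Qed.

Lemma continuous_expRV (R : realType) (gamma eps : R) : 1 < gamma ->
  continuous (fun x : R => expR (- V gamma x / eps)).
Proof.
move=> gamma_gt1 x; apply: continuous_comp; last exact: continuous_expR.
by apply: cvgM; [apply: cvgN; exact: continuous_V|exact: cvg_cst].
Qed.

Lemma continuous_rho_inf (R : realType) (gamma eps : R) : 1 < gamma ->
  continuous (rho_inf gamma eps).
Proof.
by move=> gamma_gt1 x; apply: cvgM; [exact: cvg_cst|exact: continuous_expRV].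
Qed.

Lemma rho_inf_ge0 (R : realType) (gamma eps x : R) : 0 <= rho_inf gamma eps x.
Proof.
by rewrite mulr_ge0 ?expR_ge0// invr_ge0 Rintegral_ge0// => y _; exact: expR_ge0.
Qed.

(** * Eigenfunctions are bounded *)

Lemma integrable_lower_bound (R : realType) (D : set R) (f : R -> R) (c : R) :
  measurable D -> (@lebesgue_measure R D = +oo)%E ->
  (forall x, 0 <= f x) ->
  (@lebesgue_measure R).-integrable setT (EFin \o f) ->
  0 < c -> (forall x, D x -> c <= f x) -> False.
Proof.
move=> mD Doo f0 intf c0 cf.
suff : (+oo < +oo :> \bar R)%E by rewrite ltxx.
have /integrableP[mf foo] := intf.
apply: le_lt_trans foo.
apply: (@le_trans _ _ (\int[@lebesgue_measure R]_(x in D) (c%:E))%E).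
  by rewrite integral_cst//= Doo gt0_muley ?lte_fin.
apply: (@le_trans _ _ (\int[@lebesgue_measure R]_(x in D) (`|(f x)%:E|))%E).
  apply: ge0_le_integral => //.
  - by move=> x _; rewrite lee_fin ltW.
  - by apply: measurableT_comp => //; exact: measurable_funTS.
  - by move=> x Dx; rewrite lee_fin (le_trans (cf _ Dx))// ler_norm.
apply: ge0_subset_integral => //.
exact: measurableT_comp.
Qed.

(** Square integrability excludes the growing alternative at both ends; the
left end reduces to the right one because the equation is invariant under
x |-> - x. *)
Lemma eigenfunction_half_line (R : realType) (gamma l : R) (u : R -> R) :
  1 < gamma -> 0 <= l -> (forall x : R, 0 < rho_inf gamma 1 x) ->
  eigenfunction gamma 1 l u ->
  (exists C : R, forall x : R, l + 1 <= x -> `|u x| <= C) /\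
  (exists C : R, forall x : R, l + 1 <= x -> `|u (- x)| <= C).
Proof.
move=> gamma_gt1 l_ge0 rho_gt0 [[_ intu] _ du d2u eigen].
have ode (x : R) : derive1 (derive1 u) x =
    derive1 (V gamma) x * derive1 u x - l * u x.
  by rewrite -eigen /generator; ring.
pose Z : R := \int[@lebesgue_measure R]_y expR (- V gamma y / 1).
have Z_gt0 : 0 < Z^-1.
  by have := rho_gt0 0; rewrite /rho_inf -/Z pmulr_lgt0 ?expR_gt0.
have rhoE (x : R) : rho_inf gamma 1 x = Z^-1 * expR (- V gamma x).
  by rewrite /rho_inf -/Z divr1.
have f_ge0 (x : R) : 0 <= u x ^+ 2 * rho_inf gamma 1 x.
  by rewrite mulr_ge0 ?sqr_ge0 ?ltW.
split.
- have [||//|[c c0 [A cA]]] := ode_bounded_or_not_L2 _ l u (derive1 u) gamma_gt1 l_ge0.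
  + by move=> x _; exact: derivable_is_derive1.
  + move=> x x0; have := derivable_is_derive1 _ _ _ (d2u x).
    by rewrite ode derive1_VE// gtr0_sg// mul1r gtr0_norm.
  exfalso.
  have Zc : 0 < Z^-1 * c by rewrite mulr_gt0.
  apply: (integrable_lower_bound _ `[Num.max A 0, +oo[ _ _ _ _ f_ge0 intu Zc) => //.
    by rewrite lebesgue_measure_itv/= ltry.
  move=> x; rewrite /= in_itv/= andbT ge_max => /andP[Ax x0].
  by rewrite rhoE mulrCA ler_wpM2l ?(ltW Z_gt0)// VE_ge0// cA.
- have [||//|[c c0 [A cA]]] := ode_bounded_or_not_L2 _ l (u \o -%R)
     (fun x => - derive1 u (- x)) gamma_gt1 l_ge0.
  + move=> x _; have ? := derivable_is_derive1 _ _ _ (du (- x)).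
    by apply: is_derive_eq; rewrite /GRing.scale/=; ring.
  + move=> x x0; have := derivable_is_derive1 _ _ _ (d2u (- x)).
    rewrite ode derive1_VE// sgrN gtr0_sg// normrN gtr0_norm// => h.
    have ? := @is_derive1_comp _ _ -%R x _ _ h (is_deriveN (is_derive_id x 1)).
    rewrite (_ : (fun x => - _ ) = - (derive1 u \o -%R))//.
    by apply: is_derive_eq; rewrite /GRing.scale/=; ring.
  exfalso.
  have Zc : 0 < Z^-1 * c by rewrite mulr_gt0.
  apply: (integrable_lower_bound _ `]-oo, (Num.min (- A) 0)] _ _ _ _ f_ge0 intu Zc) => //.
    by rewrite lebesgue_measure_itv/= ltNyr.
  move=> x; rewrite /= in_itv/= le_min lerNr => /andP[Ax x0].
  rewrite rhoE mulrCA ler_wpM2l ?(ltW Z_gt0)// -VN VE_ge0 ?oppr_ge0//.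
  by have /= := cA _ Ax; rewrite opprK.
Qed.

Lemma eigenfunction_bounded (R : realType) (gamma l : R) (u : R -> R) :
  1 < gamma -> 0 <= l -> (forall x : R, 0 < rho_inf gamma 1 x) ->
  eigenfunction gamma 1 l u -> exists B : R, forall x : R, `|u x| <= B.
Proof.
move=> gamma_gt1 l_ge0 rho_gt0 eu.
have [[C1 h1] [C2 h2]] := eigenfunction_half_line _ _ _ _ gamma_gt1 l_ge0 rho_gt0 eu.
have [_ _ du _ _] := eu.
have cu : {within `[- (l + 1), l + 1], continuous (fun x => `|u x|)}.
  apply: continuous_subspaceT => x.
  apply: continuous_comp; last exact: norm_continuous.
  exact/differentiable_continuous/derivable1_diffP/du.
have [|c _ h3] := EVT_max _ cu; first by lra.
exists (Num.max (Num.max C1 C2) `|u c|) => x; rewrite !le_max.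
have [/h1 ->//|xl] := leP (l + 1) x.
have [lx|lx] := leP (l + 1) (- x).
  by have := h2 _ lx; rewrite opprK => ->; rewrite orbT.
by rewrite h3 ?orbT// in_itv/= lerNl !ltW.
Qed.

(** * Scaling *)

Lemma integral_scale (R : realType) (b : R) (f : R -> R) : 0 < b ->
  continuous f -> (forall x, 0 <= f x) ->
  (\int[@lebesgue_measure R]_x (f x)%:E =
   \int[@lebesgue_measure R]_x (f (b * x) * b)%:E)%E.
Proof.
move=> b0 cf f0.
have dF (x : R) : is_derive x 1 ( *%R b) b.
  have ? := is_derive_id x (1 : R).
  apply: is_derive_eq.
  by rewrite /GRing.scale/= mulr1.
have F'E : derive1 ( *%R b) = fun=> b.
  by apply/funext => x; rewrite derive1E derive_val.
rewrite (increasing_ge0_integration_by_substitutionT (F := *%R b)) ?F'E//.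
- by move=> x y xy; rewrite ltr_pM2l.
- by move=> x; exact: cvg_cst.
- exact: is_cvg_cst.
- exact: is_cvg_cst.
- exact: (@gt0_cvgMrNy _ _ _ _ id).
- exact: (@gt0_cvgMry _ _ _ _ id).
Qed.

(** Both sides vanish when [x] is infinite. *)
Lemma fine_mulr_gt0 (R : realType) (x : \bar R) (b : R) : 0 < b ->
  fine (x * b%:E)%E = fine x * b.
Proof.
by move=> b0; case: x => [r||]//=; rewrite ?gt0_mulye ?gt0_mulNye ?lte_fin//= mul0r.
Qed.

Section Scaling.
Context {R : realType}.
Variables (gamma eps b : R).
Hypotheses (gamma_gt1 : 1 < gamma) (eps_gt0 : 0 < eps) (b_gt0 : 0 < b).

Let beps := b `^ (gamma + 1) * eps.

Lemma V_scale (x : R) : V gamma (b * x) = b `^ (gamma + 1) * V gamma x.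
Proof.
by rewrite /V normrM powRM// (gtr0_norm b_gt0) mulrCA.
Qed.

Lemma expRV_scale (x : R) : - V gamma (b * x) / beps = - V gamma x / eps.
Proof.
rewrite V_scale /beps; field.
by rewrite !gt_eqF// powR_gt0.
Qed.

(** The factor [b] is the Jacobian: the dilation by [b] sends the equilibrium
density at [eps] to that at [beps]. *)
Lemma rho_inf_scale (x : R) : rho_inf gamma beps (b * x) * b = rho_inf gamma eps x.
Proof.
rewrite /rho_inf expRV_scale.
set Z' := (X in X^-1 * _ * b); set Z := (X in _ = X^-1 * _).
suff -> : Z' = Z * b.
  by rewrite invfM -mulrA [_ * b]mulrC mulrA mulfVK// gt_eqF.
rewrite /Z' /Z /Rintegral (integral_scale _ b (fun y => expR (- V gamma y / beps)))//.
- under [in LHS]eq_integral do rewrite expRV_scale EFinM.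
  rewrite ge0_integralZr//.
  + by rewrite fine_mulr_gt0.
  + apply/measurable_EFinP; apply: continuous_measurable_fun.
    exact: continuous_expRV.
  + by rewrite lee_fin ltW.
- exact: continuous_expRV.
Qed.

Lemma sqr_integral_scale (u : R -> R) : continuous u ->
  (\int[@lebesgue_measure R]_x (u x ^+ 2 * rho_inf gamma beps x)%:E =
   \int[@lebesgue_measure R]_x (u (b * x) ^+ 2 * rho_inf gamma eps x)%:E)%E.
Proof.
move=> cu; rewrite (integral_scale _ b (fun x => u x ^+ 2 * rho_inf gamma beps x))//.
- by under [in LHS]eq_integral do rewrite -mulrA rho_inf_scale.
- move=> x; apply: cvgM; last exact: continuous_rho_inf.
  by apply: cvgM; exact: cu.
- by move=> x; rewrite mulr_ge0 ?sqr_ge0 ?rho_inf_ge0.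
Qed.

Lemma inner_scale (u : R -> R) : continuous u ->
  inner gamma beps u u = inner gamma eps (u \o ( *%R b)) (u \o ( *%R b)).
Proof.
move=> cu; rewrite /inner /Rintegral.
by congr fine; exact: sqr_integral_scale.
Qed.

Lemma L2_scale (u : R -> R) : continuous u ->
  L2 gamma beps u -> L2 gamma eps (u \o ( *%R b)).
Proof.
move=> cu [mu intu].
have cub : continuous (u \o ( *%R b)).
  move=> x; apply: continuous_comp; last exact: cu.
  by apply: cvgM; [exact: cvg_cst|exact: cvg_id].
have muv : measurable_fun setT (u \o ( *%R b)) by exact: continuous_measurable_fun.
split => //; apply/integrableP; split.
  apply/measurable_EFinP/measurable_funM; first exact: measurable_funX.
  by apply: continuous_measurable_fun; exact: continuous_rho_inf.
have abs_id (v : R -> R) (e : R) :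
    (\int[@lebesgue_measure R]_x `|(v x ^+ 2 * rho_inf gamma e x)%:E| =
     \int[@lebesgue_measure R]_x (v x ^+ 2 * rho_inf gamma e x)%:E)%E.
  apply: eq_integral => x _; rewrite gee0_abs// lee_fin.
  by apply: mulr_ge0; [exact: sqr_ge0|exact: rho_inf_ge0].
have /integrableP[_] := intu.
by rewrite !abs_id sqr_integral_scale.
Qed.

(** After multiplication by [b ^ (1 - gamma)], the diffusion coefficient
[b ^ (gamma + 1) eps] becomes [b ^ 2 eps] and the drift [V' (b x)] becomes
[b V' x]: these are the factors produced by differentiating [u (b x)]. *)
Lemma eigenfunction_scale (l : R) (u : R -> R) : eigenfunction gamma beps l u ->
  eigenfunction gamma eps (b `^ (1 - gamma) * l) (u \o ( *%R b)).
Proof.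
move=> [L2u [x0 ux0] du d2u eigen].
have b_neq0 : b != 0 by rewrite gt_eqF.
have cu : continuous u.
  by move=> x; exact/differentiable_continuous/derivable1_diffP/du.
have dF (x : R) : is_derive x 1 ( *%R b) b.
  have ? := is_derive_id x (1 : R).
  by apply: is_derive_eq; rewrite /GRing.scale/= mulr1.
have dub (x : R) : is_derive x 1 (u \o ( *%R b)) (b * derive1 u (b * x)).
  have ? := derivable_is_derive1 _ _ _ (du (b * x)).
  by apply: is_derive_eq; rewrite mulrC.
have ub'E : derive1 (u \o ( *%R b)) = fun x => b * derive1 u (b * x).
  by apply/funext => x; rewrite derive1E derive_val.
have d2ub (x : R) : is_derive x 1 (fun x => b * derive1 u (b * x))
    (b ^+ 2 * derive1 (derive1 u) (b * x)).
  have h := derivable_is_derive1 _ _ _ (d2u (b * x)).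
  have ? := is_derive1_comp h (dF x).
  rewrite (_ : (fun _ => _) = cst b * (derive1 u \o ( *%R b)))//.
  by apply: is_derive_eq; rewrite /GRing.scale/=; ring.
split.
- exact: L2_scale.
- by exists (b^-1 * x0); rewrite /= mulVKf.
- by move=> x; have [] := dub x.
- by move=> x; rewrite ub'E; have [] := d2ub x.
move=> x; rewrite /generator ub'E derive1E.
have [_ ->] := d2ub x.
have := eigen (b * x); rewrite /generator /= -mulrA => <-.
rewrite !derive1_VE// sgrM (gtr0_sg b_gt0) mul1r normrM (gtr0_norm b_gt0) powRM ?normr_ge0 ?(ltW b_gt0)//.
have b1 : b `^ (1 - gamma) * b `^ gamma = b.
  by rewrite -powRD ?b_neq0 ?implybT// subrK powRr1 ?ltW.
have b2 : b `^ (1 - gamma) * beps = b ^+ 2 * eps.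
  rewrite /beps mulrA -powRD ?b_neq0 ?implybT//.
  by rewrite (_ : 1 - gamma + (gamma + 1) = 2%:R) ?powR_mulrn ?ltW//; ring.
have -> : b `^ (1 - gamma) * - (beps * derive1 (derive1 u) (b * x) -
    Num.sg x * (b `^ gamma * `|x| `^ gamma) * derive1 u (b * x)) =
  - (b `^ (1 - gamma) * beps * derive1 (derive1 u) (b * x) -
    Num.sg x * (b `^ (1 - gamma) * b `^ gamma * `|x| `^ gamma) *
    derive1 u (b * x)) by ring.
rewrite b1 b2; ring.
Qed.

End Scaling.

(** * Averages against probability densities *)

(** The real-valued integral is 0 when the extended one is infinite, so a total
mass equal to 1 entails integrability. *)
Lemma density_integrable (R : realType) (p : R -> R) :
  measurable_fun setT p -> (forall x, 0 <= p x) ->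
  \int[@lebesgue_measure R]_x p x = 1 ->
  (@lebesgue_measure R).-integrable setT (EFin \o p).
Proof.
move=> mp p0 p1; apply/integrableP; split; first exact/measurable_EFinP.
have -> : (\int[@lebesgue_measure R]_x `|(EFin \o p) x| =
           \int[@lebesgue_measure R]_x (p x)%:E)%E.
  by apply: eq_integral => x _; rewrite /= ger0_norm.
move: p1; rewrite /Rintegral.
case: (integral _ _ _) => [r _|/eqP|/eqP] /=.
- exact: ltry.
- by rewrite eq_sym oner_eq0.
- by rewrite eq_sym oner_eq0.
Qed.

Lemma normr_mean_le (R : realType) (p f : R -> R) (M : R) :
  measurable_fun setT p -> (forall x, 0 <= p x) ->
  \int[@lebesgue_measure R]_x p x = 1 ->
  measurable_fun setT f -> (forall x, `|f x| <= M) ->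
  `|\int[@lebesgue_measure R]_x (f x * p x)| <= M.
Proof.
move=> mp p0 p1 mf fM.
have ip := density_integrable _ _ mp p0 p1.
have M0 : 0 <= M by apply: le_trans (fM 0).
have iMp : (@lebesgue_measure R).-integrable setT (EFin \o (fun x => M * p x)).
  by rewrite (_ : EFin \o _ = fun x => (M%:E * (EFin \o p) x)%E)//; exact: integrableZl.
have fpM (x : R) : `|f x * p x| <= M * p x.
  by rewrite normrM (ger0_norm (p0 x)) ler_wpM2r.
have ifp : (@lebesgue_measure R).-integrable setT (EFin \o (fun x => f x * p x)).
  apply: (le_integrable _ _ _ iMp) => //.
    by apply/measurable_EFinP/measurable_funM.
  by move=> x _ /=; rewrite lee_fin (le_trans (fpM x))// ler_norm.
apply: (le_trans (le_normr_Rintegral _ ifp)) => //.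
apply: (@le_trans _ _ (\int[@lebesgue_measure R]_x (M * p x))).
  apply: le_Rintegral => //.
  by have := integrable_norm ifp.
by rewrite RintegralZl// p1 mulr1.
Qed.

(** * Comparison of the spectra *)

(** Otherwise the normalising factor would be 0, and [psi 0 = 1] would have
norm 0 instead of 1. *)
Lemma spectral_rho_inf_gt0 (R : realType) (gamma eps : R) lambda psi :
  spectral_system gamma eps lambda psi -> forall x : R, 0 < rho_inf gamma eps x.
Proof.
move=> [[_ psi0] [_ [_ [_ [_ [ortho _]]]]]] x.
rewrite lt0r rho_inf_ge0 andbT.
apply/eqP => /eqP; rewrite mulf_eq0 (gt_eqF (expR_gt0 _)) orbF => /eqP Z0.
have := ortho 0%N 0%N; rewrite /inner /rho_inf Z0.
under eq_Rintegral do rewrite mul0r mulr0.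
by rewrite /Rintegral integral0 => /esym/eqP; rewrite oner_eq0.
Qed.

Lemma spectral_rho_inf_mass (R : realType) (gamma eps : R) lambda psi :
  spectral_system gamma eps lambda psi ->
  \int[@lebesgue_measure R]_x rho_inf gamma eps x = 1.
Proof.
move=> [[_ psi0] [_ [_ [_ [_ [ortho _]]]]]].
rewrite -[RHS](ortho 0%N 0%N) /inner.
by apply: eq_Rintegral => x _; rewrite psi0 !mul1r.
Qed.

(** The index [i] of [a j] among the values of [b] increases strictly with
[j]. *)
Lemma interlaced_index_le (R : realType) (a b : nat -> R) :
  (forall j, a j < a j.+1) -> (forall i, b i < b i.+1) ->
  (forall j, exists i, a j = b i) -> forall j i, a j = b i -> (j <= i)%N.
Proof.
move=> a_lt b_lt ab; have bmono : {homo b : x y / (x <= y)%N >-> x <= y}.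
  by apply: homo_leq => // [y x z|i]; [exact: le_trans|exact: ltW].
elim=> // j IH i ji.
have [i' ji'] := ab j.
apply: (leq_ltn_trans (IH _ ji')); rewrite ltnNge; apply/negP => /bmono.
by rewrite -ji -ji' leNgt a_lt.
Qed.

Section Transfer.
Context {R : realType}.
Variables (gamma eps b : R).
Hypotheses (gamma_gt1 : 1 < gamma) (eps_gt0 : 0 < eps) (b_gt0 : 0 < b).
Variables (lambda lambda' : nat -> R) (psi psi' : nat -> R -> R).
Hypothesis spec : spectral_system gamma eps lambda psi.
Hypothesis spec' : spectral_system gamma (b `^ (gamma + 1) * eps) lambda' psi'.

(** Eigenvalues are simple and the rescaled eigenfunction has norm 1, so it
agrees with some [psi j] up to sign. *)
Lemma spectral_transfer (k : nat) : exists2 j : nat,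
  lambda j = b `^ (1 - gamma) * lambda' k &
  forall x : R, `|psi' k (b * x)| = `|psi j x|.
Proof.
have [_ [_ [_ [eig [complete [ortho _]]]]]] := spec.
have [_ [_ [_ [eig' [_ [ortho' _]]]]]] := spec'.
have eb := eigenfunction_scale _ _ _ gamma_gt1 eps_gt0 b_gt0 _ _ (eig' k).
have [j [lj [c uc]]] := complete _ _ eb.
exists j => // x.
suff c1 : `|c| = 1 by have /= -> := uc x; rewrite normrM c1 mul1r.
have cpsi' : continuous (psi' k).
  move=> y; apply/differentiable_continuous/derivable1_diffP.
  by have [_ _ /(_ y)] := eig' k.
have := inner_scale _ _ _ gamma_gt1 eps_gt0 b_gt0 _ cpsi'.
rewrite ortho' eqxx.
have -> : inner gamma eps (psi' k \o *%R b) (psi' k \o *%R b) =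
    c ^+ 2 * inner gamma eps (psi j) (psi j).
  rewrite /inner -RintegralZl//; last by have [[_ +] _ _ _ _] := eig j.
  by apply: eq_Rintegral => y _; rewrite !uc; ring.
rewrite ortho eqxx mulr1 => /esym c2.
by rewrite -sqrtr_sqr c2 sqrtr1.
Qed.

End Transfer.

(** The bound is the one valid for the first [n + 1] eigenfunctions at level 1.
Transferring the spectrum in both directions shows that the index [j] of the
eigenfunction matched with [psi k] satisfies [j <= k]. *)
Lemma spectral_uniform_bound (R : realType) (gamma : R) (n : nat) lambda1 psi1 :
  1 < gamma -> spectral_system gamma 1 lambda1 psi1 ->
  exists B : R, forall (eps : R) lambda psi, 0 < eps ->
    spectral_system gamma eps lambda psi ->
    forall k (x : R), (k <= n)%N -> `|psi k x| <= B.
Proof.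
move=> gamma_gt1 spec1.
have [[l0 _] [lS [_ [eig1 _]]]] := spec1.
have l_ge0 (k : nat) : 0 <= lambda1 k.
  by elim: k => [|k IH]; [rewrite l0|exact: le_trans (ltW (lS k))].
have [B hB] : exists B : R, forall j (x : R), (j <= n)%N -> `|psi1 j x| <= B.
  elim: n => [|m [B hB]].
    have [B hB] := eigenfunction_bounded _ _ _ _ gamma_gt1 (l_ge0 0%N)
      (spectral_rho_inf_gt0 _ _ _ _ _ spec1) (eig1 0%N).
    by exists B => j x; rewrite leqn0 => /eqP ->.
  have [B' hB'] := eigenfunction_bounded _ _ _ _ gamma_gt1 (l_ge0 m.+1)
    (spectral_rho_inf_gt0 _ _ _ _ _ spec1) (eig1 m.+1).
  exists (Num.max B B') => j x; rewrite leq_eqVlt le_max => /predU1P[->|jm].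
    by rewrite hB' orbT.
  by rewrite hB.
exists B => eps lambda psi eps_gt0 spec k x kn.
pose b := eps `^ (gamma + 1)^-1.
have b_gt0 : 0 < b by exact: powR_gt0.
have g1_neq0 : gamma + 1 != 0 by rewrite gt_eqF//; lra.
have bE : b `^ (gamma + 1) * 1 = eps.
  by rewrite mulr1 /b -powRrM mulVf// powRr1 ?ltW.
have bE' : b^-1 `^ (gamma + 1) * eps = 1.
  by rewrite -bE mulr1 -powRM ?invr_ge0 ?ltW// mulVf ?gt_eqF// powR1.
have spec' : spectral_system gamma (b `^ (gamma + 1) * 1) lambda psi by rewrite bE.
have spec1' : spectral_system gamma (b^-1 `^ (gamma + 1) * eps) lambda1 psi1.
  by rewrite bE'.
have [j lj psij] :=
  spectral_transfer _ _ _ gamma_gt1 ltr01 b_gt0 _ _ _ _ spec1 spec' k.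
have bV_gt0 : 0 < b^-1 by rewrite invr_gt0.
have [_ [lS' _]] := spec.
have jk : (j <= k)%N.
  apply: (interlaced_index_le _ _ (fun i => b `^ (1 - gamma) * lambda i) lS _ _ _ _ lj).
    by move=> i; rewrite ltr_pM2l ?powR_gt0.
  move=> i.
  have [i' li' _] :=
    spectral_transfer _ _ _ gamma_gt1 eps_gt0 bV_gt0 _ _ _ _ spec spec1' i.
  exists i'; rewrite li' mulrA -powRM ?invr_ge0 ?ltW// mulfV ?gt_eqF//.
  by rewrite powR1 mul1r.
rewrite -(mulVKf (lt0r_neq0 b_gt0) x) psij hB//.
exact: leq_trans kn.
Qed.

(** * The distance is bounded *)

(** The coefficients of [p / rho_inf] are averages of the [psi k] under the
probability density [p], and the remaining integral is an average under the
equilibrium density. *)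
Lemma chi2_dist_le (R : realType) (gamma eps B : R) (n : nat) lambda psi
    (p : R -> R) :
  1 < gamma -> spectral_system gamma eps lambda psi ->
  (forall k x, (k <= n)%N -> `|psi k x| <= B) ->
  (forall x, 0 <= p x) -> \int[@lebesgue_measure R]_x p x = 1 ->
  L2 gamma eps (fun x => p x / rho_inf gamma eps x) ->
  chi2_dist gamma eps psi n p <= B ^+ 2 *+ n.+1 + 1.
Proof.
move=> gamma_gt1 spec psiB p0 p1 [mh _].
have rho_gt0 := spectral_rho_inf_gt0 _ _ _ _ _ spec.
have mrho : measurable_fun setT (rho_inf gamma eps).
  by apply: continuous_measurable_fun; exact: continuous_rho_inf.
have mp : measurable_fun setT p.
  rewrite (_ : p = (fun x => p x / rho_inf gamma eps x * rho_inf gamma eps x)).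
    exact: measurable_funM.
  by apply/funext => x; rewrite divfK// gt_eqF.
have mpsi k : measurable_fun setT (psi k).
  by have [_ [_ [_ [eig _]]]] := spec; have [[]] := eig k.
have B0 : 0 <= B by apply: le_trans (psiB 0%N 0 _).
pose h x := p x / rho_inf gamma eps x.
have inner_le k : (k <= n)%N -> `|inner gamma eps h (psi k)| <= B.
  move=> kn; rewrite /inner.
  under eq_Rintegral => x _.
    rewrite /h mulrAC divfK ?gt_eqF// mulrC.
    over.
  by apply: normr_mean_le => // x; exact: psiB.
have Pi_le x : `|Pi gamma eps psi n h x - 1| <= B ^+ 2 *+ n.+1 + 1.
  rewrite (le_trans (ler_normB _ _))// normr1 lerD2r.
  rewrite (le_trans (ler_norm_sum _ _ _))//.
  rewrite -[n.+1 in leRHS]card_ord -sumr_const ler_sum// => k _.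
  by rewrite normrM expr2 ler_pM// ?inner_le ?psiB// -ltnS.
have M0 : 0 <= B ^+ 2 *+ n.+1 + 1 by apply: le_trans (Pi_le 0).
rewrite /chi2_dist -[leRHS]ger0_norm// -sqrtr_sqr ler_wsqrtr//.
apply: (le_trans (ler_norm _)); apply: normr_mean_le => //.
- by move=> x; exact: rho_inf_ge0.
- exact: spectral_rho_inf_mass spec.
- apply: measurable_funX; apply: measurableT_comp => //.
  apply: measurable_funB => //.
  apply: measurable_sum => k.
  exact: measurable_funM.
- move=> x; rewrite ger0_norm ?sqr_ge0// lerXn2r ?nnegrE//.
Qed.

Theorem theorem1p8 (R : realType) (gamma x0 : R) (n : nat)
    (lambda : R -> nat -> R) (psi : R -> nat -> R -> R)
    (delta : R -> R) (rho : R -> R -> R -> R)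
    (hgamma : 1 < gamma)
    (hdelta : forall eps : R, 0 < eps <= 1 -> delta eps = 1)
    (hspec : forall eps : R, 0 < eps <= 1 ->
       spectral_system gamma eps (lambda eps) (psi eps))
    (hrho : forall eps : R, 0 < eps <= 1 ->
       fokker_planck_solution gamma eps (init_density x0 (delta eps)) (rho eps)) :
  ~ cutoff (fun eps t : R => chi2_dist gamma eps (psi eps) n (rho eps t)).
Proof.
move=> [t [t_gt0 [d_oo _]]].
have one01 : 0 < (1 : R) <= 1 by rewrite ltr01 lexx.
have [B hB] := spectral_uniform_bound _ _ n _ _ hgamma (hspec 1 one01).
have half01 : 0 < (2^-1 : R) < 1 by lra.
have /cvgryPgt/(_ (B ^+ 2 *+ n.+1 + 1)) d_big := d_oo _ half01.
have eps_small : \forall eps \near (0:R)^'+, 0 < eps <= 1.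
  near=> eps; apply/andP; split; near: eps.
    exact: nbhs_right_gt.
  exact: nbhs_right_le.
(* A single eps with a distance above the uniform bound is a contradiction. *)
have [eps [eps_big eps01]] :=
  @filter_ex _ _ (at_right_proper_filter (0 : R)) _ (filterI d_big eps_small).
have [_ [dens [hL2 _]]] := hrho _ eps01.
have s_ge0 : 0 <= 2^-1 * t eps by rewrite mulr_ge0// ltW// t_gt0.
have [rho_ge0 rho1] := dens _ s_ge0.
have [eps_gt0 _] := andP eps01.
have := chi2_dist_le _ _ _ B n _ _ _ hgamma (hspec _ eps01)
  (hB _ _ _ eps_gt0 (hspec _ eps01)) rho_ge0 rho1 (hL2 _ s_ge0).
by rewrite leNgt eps_big.
Unshelve. all: by end_near.
Qed.
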